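(* Let $q\in(0,1)$ be fixed. Let $f(x)=\sum_{k=0}^\infty a_k\phi_k(x;1)$ be a non-constant entire function of log-order $\sigma_{\log}$ smaller than $2$. Then $$\frac{1}{\sigma_{\log}-1}=\liminf_{n\to\infty}\frac{\ln\ln\frac{1}{|a_n|}}{\ln n}-1.$$
   Context: For an entire function $f$, $M(r;f):=\max\{|f(x)|:|x|=r\}$, and its log-order is $\sigma_{\log}=\sigma_{\log}(f):=\limsup_{r\to\infty}\frac{\ln^+\ln^+ M(r;f)}{\ln\ln r}$, where $\ln^+ t:=\max\{\ln t,0\}$. A non-constant entire function has log-order at least $1$. The Askey-Wilson basis at $1$ is $\phi_0(x;1):=1$ and $\phi_k(x;1):=\prod_{j=0}^{k-1}(1-2xq^j+q^{2j})=(-2)^kq^{\frac{k(k-1)}2}\prod_{j=0}^{k-1}\left(x-\frac{q^j+q^{-j}}2\right)$ for $k\ge1$. Every entire function $f$ of log-order smaller than $2$ has a unique expansion $f(x)=\sum_{k=0}^\infty a_k\phi_k(x;1)$ converging uniformly on compact subsets of $\mathbb{C}$ (its Askey-Wilson series expansion). Conventions: $\frac10=+\infty$, and $\ln\ln\frac1{|a_n|}=+\infty$ when $a_n=0$. *)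

(* Defs.v *)
From HB Require Import structures.
From mathcomp Require Import all_boot all_order all_algebra.
From mathcomp Require Import all_classical all_reals all_analysis.
From mathcomp Require Import complex.

Set Implicit Arguments.
Unset Strict Implicit.
Unset Printing Implicit Defensive.

Import Order.TTheory GRing.Theory Num.Theory.
Import numFieldNormedType.Exports.
Import Normc.

Local Open Scope classical_set_scope.
Local Open Scope ring_scope.
Local Open Scope complex_scope.

(* The norm topology and the module structure over itself are inferred on
   R[i]^o, not on R[i].  [normc : R[i] -> R] is the real-valued modulus. *)

(* Derivability in the direction 1 over the scalar field R[i] is complex
   differentiability. *)
Definition entire (R : realType) (f : R[i]^o -> R[i]^o) : Prop :=
  forall z : R[i]^o, derivable f z 1.

(* On a continuous f and for r >= 0 this supremum is a maximum (compactness
   of the circle). *)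
Definition max_modulus (R : realType) (f : R[i]^o -> R[i]^o) (r : R) : R :=
  sup [set normc (f x) | x in [set x : R[i] | normc x = r]].

(* [ln t = 0] for t <= 0 in the library, so that [lnp 0 = 0] as it should. *)
Definition lnp (R : realType) (t : R) : R := Num.max (ln t) 0.

Definition log_order (R : realType) (f : R[i]^o -> R[i]^o) : \bar R :=
  limf_esup (fun r : R => (lnp (lnp (max_modulus f r)) / ln (ln r))%:E)
            (pinfty_nbhs R).

Definition aw_basis (R : realType) (q : R) (k : nat) (x : R[i]^o) : R[i]^o :=
  \prod_(j < k) (1 - 2 * x * (q ^+ j)%:C + (q ^+ (2 * j))%:C).

Definition aw_partial_sum (R : realType) (q : R) (a : nat -> R[i])
    (n : nat) (x : R[i]^o) : R[i]^o :=
  \sum_(0 <= k < n) a k * aw_basis q k x.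

Definition is_aw_expansion (R : realType) (q : R) (a : nat -> R[i])
    (f : R[i]^o -> R[i]^o) : Prop :=
  {family compact, aw_partial_sum q a @ \oo --> f}.

(* In \bar R, [0^-1 = +oo], [lne +oo = +oo] and [lne t = -oo] for t <= 0:
   this is +oo when z = 0, and it is -oo when |z| >= 1. *)
Definition lnln_inv (R : realType) (z : R[i]) : \bar R :=
  (lne (lne ((normc z)%:E^-1)))%E.

(* Main.v *)
Require Import Defs.
From mathcomp Require Import all_boot all_order all_algebra.
From mathcomp Require Import all_classical all_reals all_analysis.
From mathcomp Require Import complex cyclic separable cyclotomic.
From mathcomp Require Import zify ring lra.

(** The logarithm of the maximum modulus and the logarithms of the
    coefficients are tied by a pair of dual inequalities.  With
    M(r) = max_modulus f r, the two conditions

      M(r) <= exp ((ln r)^s) for large r,   |a_n| <= exp (- n^p) for large n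

    correspond to each other when s and p are conjugate exponents,
    (s - 1)(p - 1) = 1, up to an arbitrarily small loss in the exponent.  The
    log-order is the infimum of the admissible s, the lower limit in the
    theorem is the supremum of the admissible p, hence the formula.

    From coefficients to f (modulus_growth): on |x| = r every factor of phi_k
    is at most 2 + 2r, because 0 < q < 1.  So |f(x)| is bounded by the sum of
    the |a_k| (4r)^k, and k ln (4r) - k^p is largest for k about
    (ln r)^(1/(p-1)), where it has the size (ln r)^(p/(p-1)).

    From f to coefficients (coef_decay): up to an explicit factor, phi_k is the
    Newton product of the x - x_j, j < k, with x_j = (q^j + q^-j)/2, so a_n is
    essentially a divided difference of f at x_0, ..., x_n.  The estimate
    normc_coef_le bounds it by a Cauchy type inequality on a circle whose
    radius r exceeds 2 q^-n, so that the disc of radius r/2 contains these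
    nodes.  Taking ln r of the size n^(1/(s-1)) gives a
    decay exp (- c n^(s/(s-1))) with some c > 0; this circle is admissible since s < 2 makes
    n^(1/(s-1)) eventually larger than n ln (1/q).

    No complex integration occurs.  The partial sums are polynomials that
    converge to f uniformly on circles and have the same coefficients a_n, so
    it is enough to prove the Cauchy type inequality for polynomials.  For them
    Taylor coefficients are averages over roots of unity (poly_coef_le), which
    gives the bound on a smaller disc (poly_half_disc_le), and dividing out one
    node after the other gives the bound on Newton coefficients
    (newton_coef_le).

    The same inequality with a fixed n >= 1 and a_n <> 0 shows M(r) >= k r for some
    k > 0, so the log-order of a non-constant f is at least 1
    (log_order_ge1). *)

Set Implicit Arguments.
Unset Strict Implicit.
Unset Printing Implicit Defensive.

Import Order.TTheory GRing.Theory Num.Theory.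
Import numFieldNormedType.Exports.
Import Normc.

Local Open Scope classical_set_scope.
Local Open Scope ring_scope.
Local Open Scope complex_scope.

(** * Cauchy estimates for polynomials in Newton form *)

(** 'X^N - 1 splits and is separable, so it has N distinct roots; these form a
    cyclic group. *)
Lemma primitive_root_exists (C : numClosedFieldType) (N : nat) :
  (0 < N)%N -> exists z : C, N.-primitive_root z.
Proof.
move=> N0; have [s Es] := closed_field_poly_normal ('X^N - 1 : {poly C}).
rewrite (monicP (monicXnsubC 1 N0)) scale1r in Es.
have rts : all N.-unity_root s.
  by apply/allP => z; rewrite -root_prod_XsubC -Es.
have sz : (N < (size s).+1)%N.
  by rewrite -(size_prod_XsubC s id) -Es size_XnsubC.
have [|z _ pz] := hasP (has_prim_root N0 rts _ sz); last by exists z.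
by rewrite -separable_prod_XsubC -Es separable_Xn_sub_1 // pnatr_eq0 -lt0n.
Qed.

Lemma sum_primitive_root (C : fieldType) (N : nat) (w : C) (m : nat) :
  N.-primitive_root w -> ~~ (N %| m)%N -> \sum_(j < N) (w ^+ j) ^+ m = 0.
Proof.
move=> pw nNm; have wm1 : w ^+ m != 1 by rewrite -(prim_order_dvd pw).
apply: (mulfI (x := w ^+ m - 1)); first by rewrite subr_eq0.
rewrite mulr0; under eq_bigr do rewrite exprAC.
by rewrite -subrX1 exprAC (prim_expr_order pw) expr1n subrr.
Qed.

(** Cauchy's inequality: the circle average of p(z) z^-k, taken over N-th roots
    of unity instead of an integral.  There is no aliasing because N is the
    size of p. *)
Lemma poly_coef_le (C : numClosedFieldType) (p : {poly C}) (r M : C) (k : nat) :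
  0 < r -> (forall z : C, `|z| = r -> `|p.[z] : C| <= M) ->
  `|p`_k : C| * r ^+ k <= M.
Proof.
move=> r0 pM; have [kp|/leq_sizeP ->//] := ltnP k (size p); last first.
  by rewrite normr0 mul0r (le_trans (normr_ge0 p.[r])) ?pM ?gtr0_norm.
set N := size p; have N0 : (0 < N)%N by exact: leq_ltn_trans kp.
have [w pw] := primitive_root_exists C N0.
have nw : `|w| = 1.
  apply/eqP; rewrite -(@pexpr_eq1 _ _ N) // -normrX (prim_expr_order pw).
  by rewrite normr1.
(* The factor w ^ (j (N - k)) is w ^ (- j k): averaging over the N-th roots of
   unity isolates the coefficient of degree k. *)
have avg : p`_k * r ^+ k *+ N =
    \sum_(j < N) p.[r * w ^+ j] * (w ^+ j) ^+ (N - k).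
  under eq_bigr do rewrite horner_coef mulr_suml.
  rewrite exchange_big (bigD1 (Ordinal kp)) //=.
  rewrite [X in _ + X]big1 ?addr0 => [|i /eqP ik].
    under eq_bigr do rewrite exprMn -!mulrA -exprD subnKC ?(ltnW kp) // exprAC
      (prim_expr_order pw) expr1n mulr1.
    by rewrite sumr_const card_ord.
  under eq_bigr do rewrite exprMn -!mulrA -exprD.
  rewrite -!mulr_sumr sum_primitive_root ?mulr0 //.
  apply: contra_notN ik => /dvdnP[c Ec]; apply/val_inj => /=.
  have := ltn_ord i; rewrite -/N; move: Ec kp; rewrite -/N.
  case: c => [|[|c]] Ec kp; rewrite ?mulSn in Ec; lia.
rewrite -(ler_pM2r (x := N%:R)) ?ltr0n //.
have -> : `|p`_k : C| * r ^+ k * N%:R = `|p`_k * r ^+ k *+ N : C|.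
  by rewrite -[X in _ = `|X|]mulr_natr !normrM normrX (gtr0_norm r0) normr_nat.
rewrite avg (le_trans (ler_norm_sum _ _ _)) // mulr_natr.
rewrite -[X in M *+ X](card_ord N) -sumr_const ler_sum // => j _.
rewrite normrM !normrX nw !expr1n mulr1 pM //.
by rewrite normrM normrX nw expr1n mulr1 gtr0_norm.
Qed.

(** A substitute for the maximum principle: the coefficient bounds are summed
    as a geometric series of ratio 1/2, which costs the factor 2. *)
Lemma poly_half_disc_le (C : numClosedFieldType) (p : {poly C}) (r M w : C) :
  0 < r -> (forall z : C, `|z| = r -> `|p.[z] : C| <= M) -> `|w| <= r / 2 ->
  `|p.[w] : C| <= 2 * M.
Proof.
move=> r0 pM wr.
have M0 : 0 <= M by rewrite (le_trans (normr_ge0 p.[r])) // pM // gtr0_norm.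
have geo (n : nat) : \sum_(i < n) (2^-1 : C) ^+ i <= 2.
  have h : 2 - 2 * (2^-1 : C) ^+ n = \sum_(i < n) (2^-1 : C) ^+ i.
    elim: n => [|n IHn]; first by rewrite big_ord0 expr0; field.
    by rewrite big_ord_recr /= -IHn exprS; field.
  by rewrite -h gerBl mulr_ge0 ?exprn_ge0 ?invr_ge0 ?ler0n.
rewrite horner_coef (le_trans (ler_norm_sum _ _ _)) //.
apply: (@le_trans _ _ (\sum_(i < size p) M * 2^-1 ^+ i)); last first.
  by rewrite -mulr_sumr mulrC ler_wpM2r.
apply: ler_sum => i _; rewrite normrM normrX.
apply: (@le_trans _ _ (`|p`_i : C| * (r / 2) ^+ i)).
  by rewrite ler_wpM2l ?lerXn2r ?nnegrE ?divr_ge0 ?(ltW r0) ?ler0n.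
rewrite exprMn mulrA ler_wpM2r ?exprn_ge0 ?invr_ge0 ?ler0n //.
exact: poly_coef_le.
Qed.

(** The first Newton coefficient is the value at the first node. *)
Lemma newton_coef0_le (C : numClosedFieldType) (N : nat) (c x : nat -> C)
    (r M : C) :
  0 < r -> `|x 0%N| <= r / 2 ->
  (forall z : C, `|z| = r ->
    `|\sum_(k < N.+1) c k * \prod_(j < k) (z - x j)| <= M) ->
  `|c 0%N| <= 2 * M.
Proof.
move=> r0 xr cM.
pose p : {poly C} := \sum_(k < N.+1) c k *: \prod_(j < k) ('X - (x j)%:P).
have pE z : p.[z] = \sum_(k < N.+1) c k * \prod_(j < k) (z - x j).
  rewrite horner_sum; apply: eq_bigr => k _; rewrite hornerZ horner_prod.
  by congr (_ * _); apply: eq_bigr => j _; rewrite hornerXsubC.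
have -> : c 0%N = p.[x 0%N].
  rewrite pE big_ord_recl big_ord0 mulr1 big1 ?addr0 // => k _.
  by rewrite big_ord_recl subrr mul0r mulr0.
by apply: poly_half_disc_le r0 _ xr => // z zr; rewrite pE cM.
Qed.

(** Subtracting the value at the first node and dividing by z - x 0 shifts the
    Newton coefficients by one.  On the circle the division gains r/2, because
    the node lies in the half disc, and the subtraction turns M into at most
    M + 2 M; each step therefore multiplies the bound by 6 / r. *)
Lemma newton_coef_le (C : numClosedFieldType) (n N : nat) (c x : nat -> C)
    (r M : C) :
  (n < N)%N -> 0 < r -> (forall j, (j <= n)%N -> `|x j| <= r / 2) ->
  (forall z : C, `|z| = r ->
    `|\sum_(k < N) c k * \prod_(j < k) (z - x j)| <= M) ->
  `|c n| <= 2 * M * (6 / r) ^+ n.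
Proof.
move=> + r0; elim: n N c x M => [|n IHn] [//|N] c x M nN xr cM.
  by rewrite expr0 mulr1; exact: newton_coef0_le r0 (xr _ _) cM.
have c0 : `|c 0%N| <= 2 * M by exact: newton_coef0_le r0 (xr _ _) cM.
pose g z := \sum_(k < N) c k.+1 * \prod_(j < k) (z - x j.+1).
have gE z : \sum_(k < N.+1) c k * \prod_(j < k) (z - x j) =
    c 0%N + (z - x 0%N) * g z.
  rewrite big_ord_recl big_ord0 mulr1 mulr_sumr; congr (_ + _).
  apply: eq_bigr => k _; rewrite big_ord_recl mulrCA; congr (_ * (_ * _)).
have gM (z : C) : `|z| = r -> `|g z| <= 6 * M / r.
  move=> zr; rewrite -(ler_pM2l (x := r / 2)) ?divr_gt0 ?ltr0n //.
  apply: (@le_trans _ _ `|(z - x 0%N) * g z|).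
    rewrite normrM ler_wpM2r // (le_trans _ (lerB_dist _ _)) //.
    rewrite lerBrDr zr [leRHS]splitr lerD2l.
    exact: xr.
  have -> : (z - x 0%N) * g z =
    \sum_(k < N.+1) c k * \prod_(j < k) (z - x j) - c 0%N by rewrite gE; ring.
  rewrite (le_trans (ler_normB _ _)) //.
  have -> : r / 2 * (6 * M / r) = M + 2 * M by field; rewrite ?gt_eqF.
  by rewrite lerD ?cM.
have := IHn N (fun k => c k.+1) (fun k => x k.+1) _ nN (fun j => xr j.+1) gM.
by congr (_ <= _); rewrite exprS; field; rewrite gt_eqF.
Qed.

(** * Locally uniform convergence of the Askey-Wilson expansion *)

Lemma normcEC (R : realType) (z : R[i]) : `|z| = (normc z)%:C.
Proof. by []. Qed.

Lemma normc_real (R : realType) (t : R) : normc t%:C = `|t|.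
Proof. by rewrite /= expr0n addr0 sqrtr_sqr. Qed.

Lemma normc_prod (R : realType) (I : Type) (s : seq I) (P : pred I)
    (F : I -> R[i]) :
  normc (\prod_(i <- s | P i) F i) = \prod_(i <- s | P i) normc (F i).
Proof. by apply: big_morph => [x y|]; [exact: normcM|exact: normc1]. Qed.

Lemma normc_sum_le (R : realType) (I : Type) (s : seq I) (P : pred I)
    (F : I -> R[i]) :
  normc (\sum_(i <- s | P i) F i) <= \sum_(i <- s | P i) normc (F i).
Proof.
elim/big_ind2: _ => // [|x1 x2 y1 y2 h1 h2]; first by rewrite normc0.
by rewrite (le_trans (le_normcD _ _)) ?lerD.
Qed.

Lemma normc_le_absD (R : realType) (x y : R) : normc (x +i* y) <= `|x| + `|y|.
Proof.
rewrite /normc -(ger0_norm (addr_ge0 (normr_ge0 x) (normr_ge0 y))) -sqrtr_sqr.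
rewrite ler_wsqrtr // sqrrD !real_normK ?num_real // lerD2r lerDl.
by rewrite mulrn_wge0 // mulr_ge0.
Qed.

Lemma abs_Re_le_normc (R : realType) (x : R[i]) : `|complex.Re x| <= normc x.
Proof. by rewrite -lecR -normcEC normc_ge_Re. Qed.

Lemma abs_Im_le_normc (R : realType) (x : R[i]) : `|complex.Im x| <= normc x.
Proof.
by case: x => x y; rewrite -sqrtr_sqr /= ler_wsqrtr // lerDr sqr_ge0.
Qed.

(** Squares are used rather than discs since they are images of products of
    real segments; every disc lies in one of them. *)
Lemma compact_square (R : realType) (r : R) :
  compact ([set x | `|complex.Re x| <= r /\ `|complex.Im x| <= r] : set R[i]^o).
Proof.
pose g (p : R * R) : R[i]^o := p.1 +i* p.2.
have -> : [set x : R[i]^o | `|complex.Re x| <= r /\ `|complex.Im x| <= r] =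
    g @` (`[- r, r] `*` `[- r, r]).
  apply/seteqP; split => [[u v] /= [ur vr]|_ [[u v] /= [ur vr] <-]] /=.
    by exists (u, v) => //=; rewrite !in_itv /= -!ler_norml.
  by move: ur vr; rewrite !in_itv /= -!ler_norml.
apply: continuous_compact; last first.
  by apply: compact_setX; exact: segment_compact.
apply: continuous_subspaceT => -[u v].
apply/(@cvgrPdist_lt R[i] R[i]^o) => e e0.
case: e e0 => e1 e2; rewrite ltcE /= => /andP[/eqP -> e0].
near=> p.
have h1 : `|u - p.1| < e1 / 2.
  near: p; exists ([set x | `|u - x| < e1 / 2], setT).
    split; last exact: filterT.
    have /cvgrPdist_lt := @cvg_id _ (nbhs u); apply; exact: divr_gt0.
  by move=> [x y] [].
have h2 : `|v - p.2| < e1 / 2.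
  near: p; exists (setT, [set x | `|v - x| < e1 / 2]).
    split; first exact: filterT.
    have /cvgrPdist_lt := @cvg_id _ (nbhs v); apply; exact: divr_gt0.
  by move=> [x y] [].
rewrite normcEC ltcR.
apply: (@le_lt_trans _ _ (`|u - p.1| + `|v - p.2|)).
  exact: normc_le_absD.
by rewrite [e1]splitr ltrD.
Unshelve. all: by end_near.
Qed.

Lemma aw_expansion_uniform (R : realType) (q : R) (a : nat -> R[i])
    (f : R[i]^o -> R[i]^o) (r e : R) :
  is_aw_expansion q a f -> 0 < e ->
  exists N, forall n x, (N <= n)%N -> normc x <= r ->
    normc (f x - aw_partial_sum q a n x) < e.
Proof.
move=> cvf e0.
have cf := (fam_cvgP _ _ _).1 cvf _ (compact_square (r := r)).
pose E : set (R[i]^o * R[i]^o) := [set xy | ball xy.1 (e%:C) xy.2].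
have entE : entourage E.
  by rewrite -entourage_from_ballE; exists e%:C => //=; rewrite ltcR.
have := cf _ [set h : R[i]^o -> R[i]^o |
  forall y, `|complex.Re y| <= r /\ `|complex.Im y| <= r -> E (f y, h y)].
case.
  by apply/uniform_nbhs; exists E; split.
move=> N _ hN; exists N => n x Nn xr.
rewrite -ltcR.
apply: (hN n Nn x); split.
  exact: le_trans (abs_Re_le_normc _) xr.
exact: le_trans (abs_Im_le_normc _) xr.
Qed.

Lemma normc_ge0 (R : realType) (x : R[i]) : 0 <= normc x.
Proof. by rewrite -ler0c -normcEC normr_ge0. Qed.

Section Basis.
Variables (R : realType) (q : R).
Hypotheses (q0 : 0 < q) (q1 : q < 1).

Lemma normc_aw_basis_le (k : nat) (x : R[i]) :
  normc (aw_basis q k x) <= (2 + 2 * normc x) ^+ k.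
Proof.
rewrite normc_prod -[k in leRHS]card_ord -prodr_const ler_prod // => j _.
rewrite normc_ge0 /= (le_trans (le_normcD _ _)) //.
have qX m : normc (q ^+ m)%:C <= 1.
  by rewrite normc_real ger0_norm ?exprn_ile1 ?exprn_ge0 ?ltW.
rewrite -[2 in leRHS]/(1 + 1) -addrA [1 + 2 * _]addrC addrA lerD ?qX //.
rewrite (le_trans (le_normcD _ _)) // normcN normcM normc1 lerD2l.
rewrite -[leRHS]mulr1 ler_pM ?normc_ge0 // normcM.
have -> : (2 : R[i]) = 2%:C by rewrite rmorphD rmorph1.
by rewrite normc_real ger0_norm.
Qed.

Lemma normc_aw_partial_sum_le (a : nat -> R[i]) (n : nat) (x : R[i]) :
  normc (aw_partial_sum q a n x) <=
  \sum_(0 <= k < n) normc (a k) * (2 + 2 * normc x) ^+ k.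
Proof.
rewrite (le_trans (normc_sum_le _ _ _)) // ler_sum // => k _.
by rewrite normcM ler_wpM2l ?normc_ge0 ?normc_aw_basis_le.
Qed.

(** The quadratic 1 - 2 x t + t^2 vanishes at x = (t + t^-1)/2. *)
Lemma aw_basis_newton (k : nat) (x : R[i]) :
  aw_basis q k x = (\prod_(j < k) (- 2 * q ^+ j)%:C) *
     \prod_(j < k) (x - ((q ^+ j + q ^- j) / 2)%:C).
Proof.
rewrite -big_split; apply: eq_bigr => j _ /=.
have qj : (q ^+ j)%:C != 0 :> R[i].
  by rewrite fmorph_eq0 expf_neq0 // gt_eqF.
have C2 : (2%:C : R[i]) = 2 by rewrite rmorphD rmorph1.
rewrite !rmorphM rmorphD rmorphN fmorphV /= fmorphV C2 mul2n -addnn.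
rewrite exprD rmorphM /=.
by field; rewrite qj.
Qed.
End Basis.

(** * Coefficients and the maximum modulus *)

Section Modulus.
Variables (R : realType) (q : R) (a : nat -> R[i]) (f : R[i]^o -> R[i]^o).
Hypotheses (q0 : 0 < q) (q1 : q < 1) (fa : is_aw_expansion q a f).

Lemma max_modulus_le (g : R[i]^o -> R[i]^o) (r B : R) :
  0 <= r -> (forall x, normc x = r -> normc (g x) <= B) -> max_modulus g r <= B.
Proof.
move=> r0 gB; apply: ge_sup => [|_ [x xr <-]]; last exact: gB.
exists (normc (g r%:C)), r%:C => //.
exact: etrans (normc_real r) (ger0_norm r0).
Qed.

(** The supremum is meaningful only because f is bounded on circles, which
    follows from uniform approximation by partial sums. *)
Lemma normc_le_max_modulus (r : R) (x : R[i]) :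
  normc x = r -> normc (f x) <= max_modulus f r.
Proof.
move=> xr; have [N hN] := aw_expansion_uniform r fa (@ltr01 R).
apply: ub_le_sup; last by exists x.
exists (1 + \sum_(0 <= k < N) normc (a k) * (2 + 2 * r) ^+ k) => _ [y yr <-].
rewrite -(subrK (aw_partial_sum q a N y) (f y)) (le_trans (le_normcD _ _)) //.
apply: lerD; first by rewrite ltW // hN // yr.
rewrite -[in leRHS]yr; exact: normc_aw_partial_sum_le.
Qed.

Lemma max_modulus_ge0 (r : R) : 0 <= r -> 0 <= max_modulus f r.
Proof.
move=> r0; apply: le_trans (normc_le_max_modulus (x := r%:C) _).
  exact: normc_ge0.
by rewrite normc_real ger0_norm.
Qed.

(** The Newton estimate applied to the partial sums, whose modulus on the circle
    exceeds max_modulus f r by an arbitrarily small amount.  The nodes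
    (q^j + q^-j)/2 with j <= n are at most q^-n; this is where the lower bound
    on r comes from.  The normalisation of phi_n has modulus
    2^n q^(n(n-1)/2). *)
Lemma normc_coef_le (n : nat) (r : R) :
  2 * q ^- n <= r ->
  normc (a n) <= 2 * max_modulus f r * (3 / r) ^+ n * q ^- 'C(n, 2).
Proof.
move=> qr; have r0 : 0 < r.
  by rewrite (lt_le_trans _ qr) // mulr_gt0 ?invr_gt0 ?exprn_gt0.
pose d k : R := \prod_(j < k) (2 * q ^+ j).
have d0 k : 0 < d k by apply: prodr_gt0 => j _; rewrite mulr_gt0 ?exprn_gt0.
have dE k : d k = 2 ^+ k * q ^+ 'C(k, 2).
  rewrite /d big_split /= prodr_const card_ord; congr (_ * _).
  by rewrite -triangular_sum big_mkord expr_sum.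
suff H e : 0 < e ->
    normc (a n) * d n <= 2 * (max_modulus f r + e) * (6 / r) ^+ n.
  have : normc (a n) * d n <= 2 * max_modulus f r * (6 / r) ^+ n.
    apply/ler_addgt0Pr => e e0.
    pose e' := e / (2 * (6 / r) ^+ n).
    have p0 : 0 < 2 * (6 / r) ^+ n by rewrite mulr_gt0 ?exprn_gt0 ?divr_gt0.
    rewrite (le_trans (H e' _)) ?divr_gt0 //.
    rewrite mulrDr mulrDl lerD2l [2 * e']mulrC -mulrA /e' divfK ?gt_eqF //.
  rewrite dE -ler_pdivlMr ?mulr_gt0 ?exprn_gt0 //.
  move/le_trans; apply.
  rewrite invfM mulrA ler_wpM2r ?invr_ge0 ?exprn_ge0 ?(ltW q0) //.
  have -> : 3 / r = 6 / r / 2 by field; rewrite gt_eqF.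
  by rewrite [(6 / r / 2) ^+ n]exprMn exprVn mulrA.
move=> e0; have [N hN] := aw_expansion_uniform r fa e0.
set m := maxn N n.+1.
pose c k : R[i] := a k * \prod_(j < k) (- 2 * q ^+ j)%:C.
pose x j : R[i] := ((q ^+ j + q ^- j) / 2)%:C.
have nc : normc (c n) = normc (a n) * d n.
  rewrite normcM normc_prod; congr (_ * _); apply: eq_bigr => j _.
  by rewrite normc_real mulNr normrN ger0_norm // mulr_ge0 ?exprn_ge0 ?ltW.
have rC : 0 < r%:C by rewrite ltcR.
have := @newton_coef_le R[i] n m c x r%:C ((max_modulus f r + e)%:C) _ rC.
rewrite normcEC nc.
have -> : 2 * (max_modulus f r + e)%:C * (6 / r%:C) ^+ n =
    (2 * (max_modulus f r + e) * (6 / r) ^+ n)%:C.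
  by rewrite !rmorphM rmorphXn /= rmorphM /= fmorphV !rmorph_nat.
rewrite lecR; apply=> [|j jn|z]; first exact: leq_maxr.
  rewrite normcEC normc_real -[2]/(2%:R) -(rmorph_nat (real_complex R)).
  rewrite -fmorphV -rmorphM lecR.
  have qj : q ^- j <= q ^- n.
    rewrite lef_pV2 ?posrE ?exprn_gt0 // ler_wiXn2l //; exact: ltW.
  have qj1 : q ^+ j <= 1 by rewrite exprn_ile1 ?ltW.
  have qj2 : 1 <= q ^- j by rewrite -invr1 lef_pV2 ?posrE ?exprn_gt0 ?ltr01.
  have qj0 : 0 < q ^+ j by rewrite exprn_gt0.
  rewrite ger0_norm ?divr_ge0 ?addr_ge0 ?(ltW qj0) ?invr_ge0 ?(ltW qj0) //.
  by rewrite ler_pM2r ?invr_gt0 //; lra.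
rewrite normcEC => /complexI zr; rewrite normcEC lecR.
rewrite (_ : \sum_(k < m) _ = aw_partial_sum q a m z); last first.
  rewrite /aw_partial_sum big_mkord; apply: eq_bigr => k _.
  by rewrite (aw_basis_newton q0) mulrA.
rewrite -[X in normc X](subrK (f z)) (le_trans (le_normcD _ _)) // addrC lerD //.
  exact: normc_le_max_modulus.
by rewrite -normcN opprB ltW // hN ?zr ?leq_maxl.
Qed.

End Modulus.

(** * Upper and lower limits as eventual inequalities *)

(** For x >= exp (|K| / (w - m)) one has x^(w - m) >= exp |K| >= K. *)
Lemma powR_dominates (R : realType) (K m w : R) :
  m < w -> exists2 b : R, 1 <= b & forall x, b <= x -> K * x `^ m <= x `^ w.
Proof.
move=> mw; have wm : 0 < w - m by rewrite subr_gt0.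
exists (expR (`|K| / (w - m))).
  by rewrite -expR0 ler_expR divr_ge0 // ltW.
move=> x bx; have x0 : 0 < x by rewrite (lt_le_trans _ bx) ?expR_gt0.
rewrite -[w](subrK m) powRD; last by rewrite (gt_eqF x0) implybT.
rewrite ler_wpM2r ?powR_ge0 //.
rewrite /powR gt_eqF // (le_trans (ler_norm K)) //.
apply: (@le_trans _ _ (1 + `|K|)); first by rewrite lerDr.
rewrite (le_trans (expR_ge1Dx _)) // ler_expR mulrC -ler_pdivrMr //.
by rewrite -ler_expR lnK ?posrE.
Qed.

Lemma powR_dominates_nat (R : realType) (K m w : R) :
  m < w -> exists2 N : nat, (0 < N)%N &
    forall n, (N <= n)%N -> K * n%:R `^ m <= n%:R `^ w.
Proof.
move=> mw; have [b b1 hb] := powR_dominates K mw.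
have b0 : 0 <= b by exact: le_trans b1.
exists (Num.bound b) => [|n bn].
  by rewrite -(ltr_nat R); exact: le_lt_trans b0 (archi_boundP b0).
apply: hb; rewrite (le_trans (ltW (archi_boundP b0))) // ler_nat //.
Qed.

Lemma ereal_lt_between (R : realType) (x : \bar R) (y : R) :
  (x < y%:E)%E -> exists2 s : R, (x < s%:E)%E & s < y.
Proof.
case: x => [x|//|]; rewrite ?lte_fin => xy.
  by exists ((x + y) / 2); rewrite ?lte_fin; lra.
by exists (y - 1); rewrite ?ltNyr //; lra.
Qed.

Section Limits.
Variables (R : realType).

Lemma le_limn_einf (u : nat -> \bar R) (c : \bar R) (N : nat) :
  (forall n, (N <= n)%N -> (c <= u n)%E) -> (c <= limn_einf u)%E.
Proof.
move=> cu; have -> : limn_einf u = limf_einf u \oo by [].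
rewrite limf_einfE; apply: le_ereal_sup_tmp.
exists (ereal_inf (u @` [set n | (N <= n)%N])).
  by exists [set n | (N <= n)%N] => //; exists N.
by apply: le_ereal_inf_tmp => _ [n /= Nn <-]; exact: cu.
Qed.

Lemma lt_limn_einf (u : nat -> \bar R) (c : \bar R) :
  (c < limn_einf u)%E -> exists N, forall n, (N <= n)%N -> (c < u n)%E.
Proof.
have -> : limn_einf u = limf_einf u \oo by [].
rewrite limf_einfE => /ereal_sup_gt[_ [V [N _ NV] <-] cV].
exists N => n Nn; apply: (lt_le_trans cV); apply: ereal_inf_lbound.
by exists n => //; exact: NV.
Qed.

(** For r > exp 1 the quotient in the log-order has a positive denominator, and
    both truncated logarithms can be exponentiated. *)
Lemma log_order_lt (f : R[i]^o -> R[i]^o) (s : R) :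
  (log_order f < s%:E)%E ->
  exists r0, forall r, r0 <= r -> max_modulus f r <= expR (ln r `^ s).
Proof.
move=> /ereal_inf_lt[_ [V [b [_ bV]] <-] Vs].
exists (Num.max (b + 1) (expR 2)) => r; rewrite ge_max => /andP[br er].
have r0 : 0 < r by rewrite (lt_le_trans _ er) ?expR_gt0.
have L1 : 1 < ln r.
  by rewrite -ltr_expR lnK ?posrE // (lt_le_trans _ er) // ltr_expR ltr1n.
have LL0 : 0 < ln (ln r) by exact: ln_gt0.
have Vr : V r by apply: bV; rewrite (lt_le_trans _ br) // ltrDl.
have : ((lnp (lnp (max_modulus f r)) / ln (ln r))%:E < s%:E)%E.
  by apply: le_lt_trans Vs; apply: ereal_sup_ubound; exists r.
rewrite lte_fin ltr_pdivrMr // => /ltW.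
set M := max_modulus f r => h.
have h1 : lnp M <= ln r `^ s.
  have [M0|M0] := leP (lnp M) 0; first by rewrite (le_trans M0) ?powR_ge0.
  rewrite /powR gt_eqF ?(lt_trans ltr01) //.
  rewrite -[leLHS](lnK (x := lnp M)) ?posrE // ler_expR (le_trans _ h) //.
  by rewrite /lnp le_max lexx.
have [M0|M0] := leP M 0; first by rewrite (le_trans M0) ?expR_ge0.
rewrite -[leLHS](lnK (x := M)) ?posrE // ler_expR (le_trans _ h1) //.
by rewrite /lnp le_max lexx.
Qed.

Lemma le_log_order (f : R[i]^o -> R[i]^o) (s r0 : R) : 0 <= s ->
  (forall r, r0 <= r -> max_modulus f r <= expR (ln r `^ s)) ->
  (log_order f <= s%:E)%E.
Proof.
move=> s0 fs; apply: ge_ereal_inf.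
exists (ereal_sup [set (lnp (lnp (max_modulus f r)) / ln (ln r))%:E |
  r in [set r | Num.max r0 (expR 2) < r]]).
  exists [set r | Num.max r0 (expR 2) < r] => //.
  by exists (Num.max r0 (expR 2)); split; rewrite ?num_real.
apply: ge_ereal_sup => _ [r /= + <-]; rewrite gt_max => /andP[br er].
have rp : 0 < r by rewrite (lt_trans _ er) ?expR_gt0.
have L1 : 1 < ln r.
  by rewrite -ltr_expR lnK ?posrE // (lt_trans _ er) // ltr_expR ltr1n.
have LL0 : 0 < ln (ln r) by exact: ln_gt0.
rewrite lee_fin ler_pdivrMr //.
have lnp_le (x y : R) : 0 <= y -> x <= expR y -> lnp x <= y.
  move=> y0 xy; rewrite /lnp ge_max y0 andbT.
  have [x0|x0] := leP x 0; first by rewrite ln0.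
  by rewrite -ler_expR lnK ?posrE.
apply: (lnp_le _ _); first by rewrite mulr_ge0 // ltW.
apply: (lnp_le _ _); first exact: expR_ge0.
rewrite (le_trans (fs _ (ltW br))) // /powR gt_eqF //; exact: lt_trans L1.
Qed.

End Limits.

Section LogLog.
Variables (R : realType) (a : nat -> R[i]).
Let u (n : nat) : \bar R := (lnln_inv (a n) / (ln n%:R)%:E)%E.

(** The conventions for z = 0 and for |z| >= 1 are the ones for which this
    equivalence has no exception when t > 0. *)
Lemma lnln_inv_ge (z : R[i]) (t : R) :
  0 < t -> (t%:E <= lnln_inv z)%E = (normc z <= expR (- expR t)).
Proof.
move=> t0; rewrite /lnln_inv.
have [->|z0] := eqVneq (normc z) 0.
  by rewrite inve0 /= leey expR_ge0.
have zp : 0 < normc z by rewrite lt_def z0 normc_ge0.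
rewrite inver (negbTE z0) lne_EFin ?invr_gt0 // lnV ?posrE //.
have [l0|l0] := ltP 0 (- ln (normc z)).
  rewrite lne_EFin // lee_fin -ler_expR lnK ?posrE // lerNr.
  by rewrite -ler_expR lnK ?posrE.
rewrite le0_lneNy ?lee_fin // leeNy_eq /=; apply/esym/negbTE; rewrite -ltNge.
rewrite -[ltRHS]lnK ?posrE // ltr_expR.
by rewrite (lt_le_trans (y := 0)) -?oppr_le0 // oppr_lt0 expR_gt0.
Qed.

Lemma lnln_ratio_ge (n : nat) (p : R) : (1 < n)%N -> 0 < p ->
  (p%:E <= u n)%E = (normc (a n) <= expR (- n%:R `^ p)).
Proof.
move=> n1 p0; have L0 : 0 < ln n%:R :> R by rewrite ln_gt0 // ltr1n.
rewrite /u inver gt_eqF // lee_pdivlMr // -EFinM lnln_inv_ge ?mulr_gt0 //.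
by rewrite /powR gt_eqF // ltr0n ltnW.
Qed.

Lemma le_limn_einf_lnln (p : R) (N : nat) : 0 < p ->
  (forall n, (N <= n)%N -> normc (a n) <= expR (- n%:R `^ p)) ->
  (p%:E <= limn_einf u)%E.
Proof.
move=> p0 ap; apply: (@le_limn_einf _ _ _ (maxn N 2)) => n.
by rewrite geq_max => /andP[Nn n1]; rewrite lnln_ratio_ge // ap.
Qed.

Lemma lt_limn_einf_lnln (p : R) : 0 < p -> (p%:E < limn_einf u)%E ->
  exists N, forall n, (N <= n)%N -> normc (a n) <= expR (- n%:R `^ p).
Proof.
move=> p0 /lt_limn_einf[N hN]; exists (maxn N 2) => n.
by rewrite geq_max => /andP[Nn n1]; rewrite -lnln_ratio_ge // ltW // hN.
Qed.

End LogLog.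

(** * Duality between growth and coefficient decay *)

Section Growth.
Variables (R : realType) (q : R) (a : nat -> R[i]) (f : R[i]^o -> R[i]^o).
Hypotheses (q0 : 0 < q) (q1 : q < 1) (fa : is_aw_expansion q a f).

(** The radius is chosen so that the two main terms balance: with
    ln r = T = (n/4)^(1/(s-1)) one has (ln r)^s = n T / 4, a quarter of the
    gain n ln r of the coefficient estimate.  The remaining terms, n^2 ln (1/q)
    included, are of order n^(1+m) with m < 1/(s-1), hence negligible
    compared with n T. *)
Lemma coef_decay (s p r0 : R) : 1 < s -> s < 2 -> p < s / (s - 1) ->
  (forall r, r0 <= r -> max_modulus f r <= expR (ln r `^ s)) ->
  exists N, forall n, (N <= n)%N -> normc (a n) <= expR (- n%:R `^ p).
Proof.
move=> s1 s2 ps fs; set w := (s - 1)^-1.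
have s10 : 0 < s - 1 by rewrite subr_gt0.
have w1 : 1 < w by rewrite invf_gt1 //; lra.
have sw : s / (s - 1) = 1 + w by rewrite /w; field; rewrite gt_eqF.
set m := Num.max 1 (p - 1).
have mw : m < w by rewrite gt_max w1 /=; move: ps; rewrite sw; lra.
set D := - ln q.
have D0 : 0 < D by rewrite oppr_gt0 ln_lt0 // q0.
(* K0 collects the constants of all lower order terms, so that a single
   comparison of powers absorbs them. *)
pose K0 := ln 2 + ln 3 + D + 1 + `|r0|.
have l2 : 0 < ln 2 :> R by rewrite ln_gt0 // ltr1n.
have l3 : 0 < ln 3 :> R by rewrite ln_gt0 // ltr1n.
have [N N0 hN] := powR_dominates_nat (4 `^ w * (4 / 3 * K0)) mw.
exists N => n Nn; have n0 : (0 < n)%N by exact: leq_trans Nn.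
have n1 : 1 <= n%:R :> R by rewrite ler1n.
have n0r : 0 < n%:R :> R by rewrite ltr0n.
pose T : R := (n%:R / 4) `^ w.
have n4 : 0 < n%:R / 4 :> R by rewrite divr_gt0.
have T0 : 0 < T by exact: powR_gt0.
have KT : 4 / 3 * K0 * n%:R `^ m <= T.
  rewrite -(ler_pM2l (x := 4 `^ w)) ?powR_gt0 // mulrA -powRM ?(ltW n4) //.
  by rewrite [4 * (_ / _)]mulrC divfK // hN.
have Ts : T `^ s = T * (n%:R / 4).
  rewrite /T -powRrM -[X in _ = _ * X](powRr1 (ltW n4)) -powRD; last first.
    by rewrite (gt_eqF n4) implybT.
  by congr (_ `^ _); rewrite /w; field; rewrite gt_eqF.
have nm1 : n%:R <= n%:R `^ m :> R.
  by rewrite -[leLHS]powRr1 ?ler0n // ler_powR // le_max lexx.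
have nmp : n%:R `^ p <= n%:R * n%:R `^ m :> R.
  rewrite -[X in X * _]powRr1 ?ler0n // -powRD; last first.
    by rewrite (gt_eqF n0r) implybT.
  by rewrite ler_powR // -lerBlDl le_max lexx orbT.
have qX k : q ^- k = expR (k%:R * D).
  by rewrite mulrN expRN expRM_natl lnK ?posrE.
set X := n%:R `^ m in nm1 nmp KT.
have X1 : 1 <= X by exact: le_trans nm1.
have nX1 : n%:R <= n%:R * X by rewrite ler_peMr // ltW.
have nX2 : n%:R * n%:R <= n%:R * X by rewrite ler_pM2l.
have K0X : ln 2 + n%:R * D + `|r0| <= T.
  apply: le_trans KT; have := ler_wpM2r (ltW D0) nm1.
  have := ler_wpM2l (ltW l2) X1; have := ler_wpM2l (normr_ge0 r0) X1.
  have := mulr_gt0 l2 (lt_le_trans ltr01 X1).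
  have := mulr_gt0 l3 (lt_le_trans ltr01 X1).
  have := mulr_gt0 D0 (lt_le_trans ltr01 X1).
  have := mulr_ge0 (normr_ge0 r0) (le_trans ler01 X1).
  rewrite /K0; lra.
have r1 : 2 * q ^- n <= expR T.
  rewrite qX -[X in X * _](lnK (x := 2)) ?posrE // -expRD ler_expR.
  by rewrite (le_trans _ K0X) // lerDl.
have r2 : r0 <= expR T.
  rewrite (le_trans (ler_norm _)) // (le_trans _ (expR_ge1Dx T)) //.
  have := mulr_gt0 n0r D0; lra.
have Mr := fs _ r2; rewrite expRK Ts in Mr.
apply: (le_trans (normc_coef_le q0 q1 fa r1)).
have -> : 3 / expR T = expR (ln 3 - T) by rewrite expRB lnK ?posrE.
rewrite -expRM_natl qX -mulrA -expRD.
apply: (@le_trans _ _ (expR (ln 2) * expR (T * (n%:R / 4)) *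
  expR (n%:R * (ln 3 - T) + 'C(n, 2)%:R * D))).
  by rewrite ler_wpM2r ?expR_ge0 // lnK ?posrE // ler_pM2l.
rewrite -!expRD ler_expR.
have Cn : 'C(n, 2)%:R <= n%:R * n%:R :> R.
  rewrite -natrM ler_nat bin2 leq_half_double (leq_trans (n := n * n)) //.
    by rewrite leq_mul2l leq_pred orbT.
  by rewrite -addnn -addnS leq_addr.
have := ler_wpM2r (ltW D0) Cn; have := ler_wpM2r (ltW D0) nX2.
have := ler_wpM2l (ltW l2) (le_trans n1 nX1).
have := ler_wpM2l (ltW l3) nX1.
have := ler_wpM2l (ltW n0r) KT.
have := mulr_ge0 (normr_ge0 r0) (le_trans ler01 (le_trans n1 nX1)).
rewrite /K0; lra.
Qed.

Lemma sum_expRN_le2 (n : nat) : \sum_(0 <= k < n) expR (- k%:R) <= 2 :> R.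
Proof.
have h : expR (-1) <= 2^-1 :> R.
  by rewrite expRN lef_pV2 ?posrE ?expR_gt0 // expR_ge1Dx.
suff : \sum_(0 <= k < n) expR (- k%:R) <= 2 - 2 * expR (- n%:R) :> R.
  by move/le_trans; apply; rewrite gerBl mulr_ge0 // expR_ge0.
elim: n => [|n IHn]; first by rewrite big_geq // oppr0 expR0; lra.
rewrite big_nat_recr //= -[n.+1%:R]natr1 opprD expRD.
have := ler_wpM2l (expR_ge0 (- n%:R : R)) h; move: IHn; lra.
Qed.

(** Put L = ln (4 r) and w = 1/(p-1).  The inequality
    k L - k^p <= (L+1)^(1+w) - k holds for all k: if k <= (L+1)^w then
    k (L+1) <= (L+1)^(1+w), and otherwise k^(p-1) >= L+1.  Its right side is a
    constant term plus the exponents of a convergent geometric series. *)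
Lemma modulus_growth (p s : R) (N : nat) : 1 < p -> p / (p - 1) < s ->
  (forall n, (N <= n)%N -> normc (a n) <= expR (- n%:R `^ p)) ->
  exists r0, forall r, r0 <= r -> max_modulus f r <= expR (ln r `^ s).
Proof.
move=> p1 ps aN; have p10 : 0 < p - 1 by rewrite subr_gt0.
set w := (p - 1)^-1; have w0 : 0 < w by rewrite invr_gt0.
have pw : p / (p - 1) = 1 + w by rewrite /w; field; rewrite gt_eqF.
rewrite pw in ps.
(* A makes the decay hypothesis valid for every index. *)
pose A : R := 1 + \sum_(0 <= k < N) normc (a k) * expR (k%:R `^ p).
have t0 k : 0 <= normc (a k) * expR (k%:R `^ p).
  by rewrite mulr_ge0 ?normc_ge0 ?expR_ge0.
have A1 : 1 <= A by rewrite lerDl sumr_ge0.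
have aA k : normc (a k) <= A * expR (- k%:R `^ p).
  have [Nk|kN] := leqP N k.
    by rewrite (le_trans (aN _ Nk)) // ler_peMl ?expR_ge0.
  rewrite expRN ler_pdivlMr ?expR_gt0 // /A big_mkord (bigD1 (Ordinal kN)) //=.
  by rewrite addrCA lerDl addr_ge0 // sumr_ge0.
have fB r : 1 <= r ->
    max_modulus f r <= 2 * A * expR ((ln (4 * r) + 1) `^ (1 + w)).
  move=> r1; have r0 : 0 < r by exact: lt_le_trans r1.
  set L := ln (4 * r); have L0 : 0 <= L by rewrite ln_ge0 //; lra.
  have L10 : 0 < L + 1 by lra.
  apply: max_modulus_le => [|x xr]; first exact: ltW.
  apply/ler_addgt0Pl => e e0; have [n hn] := aw_expansion_uniform r fa e0.
  have {}hn := hn n x (leqnn _); rewrite xr lexx in hn.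
  rewrite -(subrK (aw_partial_sum q a n x) (f x)) (le_trans (le_normcD _ _)) //.
  apply: lerD; first by rewrite ltW // hn.
  rewrite (le_trans (normc_aw_partial_sum_le q0 q1 _ _ _)) // xr.
  apply: (@le_trans _ _ (\sum_(0 <= k < n)
      A * expR ((L + 1) `^ (1 + w)) * expR (- k%:R))); last first.
    rewrite -mulr_sumr mulrC mulrA ler_wpM2r ?expR_ge0 //.
    by rewrite ler_wpM2r ?sum_expRN_le2 // (le_trans ler01).
  apply: ler_sum => k _; rewrite -[leRHS]mulrA -expRD.
  apply: (@le_trans _ _ (A * expR (- k%:R `^ p) * expR (k%:R * L))).
    apply: ler_pM; rewrite ?normc_ge0 ?exprn_ge0 ?aA //; first by lra.
    rewrite expRM_natl lnK ?posrE; last by lra.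
    by rewrite lerXn2r ?nnegrE //; lra.
  rewrite -mulrA -expRD ler_wpM2l ?(le_trans ler01) // ler_expR.
  have k0 : 0 <= k%:R :> R by exact: ler0n.
  have kp : k%:R `^ p = k%:R * k%:R `^ (p - 1).
    by rewrite mulr_powRB1 ?(lt_trans ltr01).
  have Lw : (L + 1) `^ (1 + w) = (L + 1) * (L + 1) `^ w.
    rewrite powRD ?powRr1 ?(ltW L10) //; last by rewrite (gt_eqF L10) implybT.
  have Lw0 : 0 <= (L + 1) `^ w by exact: powR_ge0.
  have [kL|Lk] := leP (k%:R) ((L + 1) `^ w).
    have := ler_wpM2l (ltW L10) kL; have := powR_ge0 (k%:R : R) p.
    rewrite Lw; lra.
  have kL : L + 1 <= k%:R `^ (p - 1).
    have -> : L + 1 = ((L + 1) `^ w) `^ (p - 1).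
      by rewrite -powRrM /w mulVf ?gt_eqF // powRr1 ?ltW.
    by rewrite ge0_ler_powR ?nnegrE // ltW.
  have := ler_wpM2l k0 kL; have := mulr_ge0 (ltW L10) Lw0.
  rewrite kp Lw; lra.
have [b b1 hb] := powR_dominates (ln (2 * A) + 2 `^ (1 + w)) ps.
have A0 : 0 < A by exact: lt_le_trans A1.
have lA : 0 <= ln (2 * A) by rewrite ln_ge0 //; lra.
have l4 : 0 < ln 4 :> R by rewrite ln_gt0 // ltr1n.
exists (expR (b + ln 4 + 1)) => r rb.
have r0 : 0 < r by rewrite (lt_le_trans _ rb) ?expR_gt0.
have Lb : b + ln 4 + 1 <= ln r by rewrite -ler_expR lnK ?posrE.
have L1 : 1 <= ln r by lra.
have r1 : 1 <= r.
  by rewrite -(ler_ln (x := 1)) ?posrE // ln1; lra.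
rewrite (le_trans (fB _ r1)) //.
rewrite -[X in X * _](lnK (x := 2 * A)) ?posrE ?mulr_gt0 //.
rewrite -expRD ler_expR [ln (4 * r)]lnM ?posrE //.
apply: (@le_trans _ _ ((ln (2 * A) + 2 `^ (1 + w)) * ln r `^ (1 + w)));
  last first.
  by apply: hb; lra.
rewrite [leRHS]mulrDl; apply: lerD.
  rewrite ler_peMr // -[leLHS]/((fun=> 1) (1 + w)) -powR1.
  by rewrite ge0_ler_powR ?nnegrE //; lra.
rewrite -powRM //; last by lra.
by rewrite ge0_ler_powR ?nnegrE //; lra.
Qed.

End Growth.

(** * The log-order formula *)

Section Final.
Variables (R : realType) (q : R) (a : nat -> R[i]) (f : R[i]^o -> R[i]^o).
Hypotheses (q0 : 0 < q) (q1 : q < 1) (fa : is_aw_expansion q a f).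

(** Otherwise all partial sums of positive length are the constant a 0. *)
Lemma exists_coef_neq0 : ~ (exists c : R[i], forall x, f x = c) ->
  exists2 n, (0 < n)%N & a n != 0.
Proof.
move=> nc; apply: contrapT => a0; apply: nc; exists (a 0%N) => x.
have az n : (0 < n)%N -> a n = 0.
  by move=> n0; apply/eqP; apply: contrapT => /negP an; apply: a0; exists n.
apply/eqP; rewrite -subr_eq0; apply/eqP/eq0_normc/eqP.
rewrite eq_le normc_ge0 andbT; apply/ler_addgt0Pr => e e0.
have [N hN] := aw_expansion_uniform (normc x) fa e0.
have := hN N.+1 x (leqnSn _) (lexx _); rewrite add0r => /ltW.
rewrite /aw_partial_sum big_nat_recl // big1_seq => [|k _]; last first.
  by rewrite az // mul0r.
by rewrite addr0 /aw_basis big_ord0 mulr1.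
Qed.

(** A nonzero a_n with n >= 1 forces max_modulus f r >= k r for some k > 0,
    which is incompatible with the bound exp ((ln r)^s), s < 1. *)
Lemma log_order_ge1 : ~ (exists c : R[i], forall x, f x = c) ->
  (1%:E <= log_order f)%E.
Proof.
move=> /exists_coef_neq0[n n0 an]; rewrite leNgt; apply/negP.
move=> /ereal_lt_between[s fs s1]; have [r0 hr0] := log_order_lt fs.
have [b b1 hb] := powR_dominates 2 s1.
pose k : R := normc (a n) / (2 * 3 ^+ n * q ^- 'C(n, 2)).
have k0 : 0 < k.
  apply: divr_gt0; last by rewrite !mulr_gt0 ?invr_gt0 ?exprn_gt0.
  rewrite lt_def normc_ge0 andbT.
  by apply: contra an => /eqP/eq0_normc/eqP.
(* Large enough for the growth bound, for the coefficient estimate, and for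
   ln r > 2 |ln k| together with 2 (ln r)^s <= ln r. *)
pose r : R := `|r0| + 2 * q ^- n + expR (b + 2 * `|ln k| + 1).
have qn : 0 < 2 * q ^- n by rewrite mulr_gt0 ?invr_gt0 ?exprn_gt0.
have e0 := expR_gt0 (b + 2 * `|ln k| + 1).
have rr0 : r0 <= r by rewrite (le_trans (ler_norm _)) // /r; lra.
have rq : 2 * q ^- n <= r by have := normr_ge0 r0; rewrite /r; lra.
have rp : 0 < r by lra.
have Lr : b + 2 * `|ln k| + 1 <= ln r.
  by rewrite -ler_expR lnK ?posrE // /r; have := normr_ge0 r0; lra.
have L1 : 1 <= ln r by have := normr_ge0 (ln k); lra.
have r1 : 1 <= r by rewrite -(ler_ln (x := 1)) ?posrE // ln1; lra.
have kM : k * r <= max_modulus f r.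
  have M0 := max_modulus_ge0 q0 q1 fa (ltW rp).
  rewrite (@le_trans _ _ (k * r ^+ n)) //.
    by rewrite ler_pM2l // ler_eXnr.
  rewrite /k mulrAC ler_pdivrMr ?mulr_gt0 ?exprn_gt0 ?invr_gt0 ?exprn_gt0 //.
  rewrite -ler_pdivlMr ?exprn_gt0 // (le_trans (normc_coef_le q0 q1 fa rq)) //.
  by rewrite expr_div_n le_eqVlt; apply/orP; left; apply/eqP; ring.
have kr : ln k + ln r <= ln r `^ s.
  rewrite -lnM ?posrE // -ler_expR lnK ?posrE ?(mulr_gt0 k0 rp) //.
  exact: le_trans kM (hr0 r rr0).
have br : b <= ln r by have := normr_ge0 (ln k); lra.
have := hb (ln r) br; rewrite powRr1; last by lra.
have := ler_norm (- ln k); rewrite normrN; move: kr; lra.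
Qed.

Local Notation ell :=
  (limn_einf (fun n : nat => lnln_inv (a n) / (ln n%:R)%:E)%E).

(** The condition (t - 1)(p - 1) < 1 means t < p/(p-1); it leaves room for an
    exponent s above the log-order with p < s/(s-1), and below 2 as the decay
    estimate requires. *)
Lemma le_limn_einf_of_log_order (p t : R) : 1 < p ->
  log_order f = t%:E -> 1 <= t -> t < 2 -> (t - 1) * (p - 1) < 1 ->
  (p%:E <= ell)%E.
Proof.
move=> p1 ft t1 t2 tp; have p10 : 0 < p - 1 by rewrite subr_gt0.
set B := Num.min 2 (p / (p - 1)).
have tB : t < B.
  by rewrite lt_min t2 /= ltr_pdivlMr //; move: tp; rewrite mulrBl mul1r; nra.
have [s ts sB] : exists2 s, t < s & s < B by exists ((t + B) / 2); lra.
move: (sB); rewrite lt_min => /andP[s2 sp].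
have s1 : 1 < s by exact: le_lt_trans ts.
have [r0 hr0] : exists r0, forall r, r0 <= r ->
    max_modulus f r <= expR (ln r `^ s).
  by apply: log_order_lt; rewrite ft lte_fin.
have [|N hN] := coef_decay q0 q1 fa s1 s2 (p := p) _ hr0.
  by move: sp; rewrite !ltr_pdivlMr ?subr_gt0 //; lra.
by apply: le_limn_einf_lnln hN; exact: lt_trans p1.
Qed.

(** Were the lower limit larger than p, the log-order would be at most every
    s > p/(p-1), hence smaller than t. *)
Lemma limn_einf_le_of_log_order (p t : R) : 1 < p ->
  log_order f = t%:E -> 1 < (t - 1) * (p - 1) -> (ell <= p%:E)%E.
Proof.
move=> p1 ft tp; have p10 : 0 < p - 1 by rewrite subr_gt0.
have pt : p / (p - 1) < t by rewrite ltr_pdivrMr //; nra.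
rewrite leNgt; apply/negP => /lt_limn_einf_lnln[|N hN].
  exact: lt_trans p1.
pose s := (p / (p - 1) + t) / 2.
have ps : p / (p - 1) < s by rewrite /s; lra.
have [r0 hr0] := modulus_growth q0 q1 fa p1 ps hN.
have s0 : 0 <= s.
  by apply: le_trans (ltW ps); rewrite divr_ge0 ?ltW //; exact: lt_trans p1.
have := le_log_order s0 hr0; rewrite ft lee_fin /s; lra.
Qed.

End Final.

Theorem theorem4p5 (R : realType) (q : R) (f : R[i]^o -> R[i]^o)
    (a : nat -> R[i]) :
  0 < q -> q < 1 ->
  entire f ->
  ~ (exists c : R[i], forall x, f x = c) ->
  (log_order f < 2%:E)%E ->
  is_aw_expansion q a f ->
  ((log_order f - 1)^-1 =
   limn_einf (fun n : nat => lnln_inv (a n) / (ln n%:R)%:E) - 1)%E.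
Proof.
move=> q0 q1 _ fnc f2 fa; have f1 := log_order_ge1 q0 q1 fa fnc.
set ell := limn_einf _.
case ft : (log_order f) => [t| |]; [|by rewrite ft in f2|by rewrite ft in f1].
move: f1 f2; rewrite ft lee_fin lte_fin => t1 t2.
have lower p : 1 < p -> (t - 1) * (p - 1) < 1 -> (p%:E <= ell)%E.
  by move=> p1; exact: (le_limn_einf_of_log_order q0 q1 fa p1 ft t1 t2).
have upper p : 1 < p -> 1 < (t - 1) * (p - 1) -> (ell <= p%:E)%E.
  by move=> p1; exact: (limn_einf_le_of_log_order q0 q1 fa p1 ft).
rewrite -EFinB inver subr_eq0.
have [t1E|t1N] := eqVneq t 1.
  suff -> : ell = +oo%E by [].
  apply/eqyP => A A0; apply: (@le_trans _ _ (A + 1)%:E).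
    by rewrite lee_fin lerDl.
  by apply: lower; rewrite ?t1E ?subrr ?mul0r // ltrDr.
have {}t1 : 0 < t - 1 by rewrite subr_gt0 lt_def t1N.
have w0 : 0 < (t - 1)^-1 by rewrite invr_gt0.
suff -> : ell = (1 + (t - 1)^-1)%:E by rewrite -EFinB addrAC subrr add0r.
apply/eqP; rewrite eq_le; apply/andP; split; apply/lee_addgt0Pr => e e0.
  rewrite -EFinD; apply: upper; first by lra.
  rewrite (_ : 1 + (t - 1)^-1 + e - 1 = (t - 1)^-1 + e); last by ring.
  by rewrite mulrDr mulfV ?gt_eqF // ltrDl mulr_gt0.
rewrite -leeBlDr // -EFinB.
(* Truncating e keeps the exponent 1 + (t - 1)^-1 - d above 1. *)
pose d := Num.min e ((t - 1)^-1 / 2).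
have d0 : 0 < d by rewrite lt_min e0 divr_gt0.
have dw : d <= (t - 1)^-1 / 2 by rewrite ge_min lexx orbT.
apply: (@le_trans _ _ (1 + (t - 1)^-1 - d)%:E).
  by rewrite lee_fin lerD2l lerN2 ge_min lexx.
apply: lower; first by lra.
rewrite (_ : 1 + (t - 1)^-1 - d - 1 = (t - 1)^-1 - d); last by ring.
by rewrite mulrBr mulfV ?gt_eqF // gtrBl mulr_gt0.
Qed.
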